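(* Let $T_1$ and $T_2$ be rooted trees. Then $T_1$ and $T_2$ are isomorphic (as rooted trees) if and only if $P(T_1)=P(T_2)$ in $\mathbb{Z}[x,y]$.
   Context: All trees are finite and unlabeled. A rooted tree is a tree with one distinguished vertex (the root); isomorphisms of rooted trees preserve the root. $\bullet$ denotes the one-vertex rooted tree. For $k\ge 1$ and rooted trees $T_1,\dots,T_k$, $\wedge_k(T_1,\dots,T_k)$ denotes the rooted tree obtained by pasting the roots of $T_1,\dots,T_k$ to the $k$ leaf vertices of the rooted $k$-star (root with $k$ children), i.e. a new root whose $k$ children are the roots of $T_1,\dots,T_k$. Every rooted tree other than $\bullet$ is of this form, uniquely up to reordering and isomorphism of the $T_i$. The polynomial $P(T)\in\mathbb{Z}[x,y]$ of a rooted tree $T$ is defined recursively by $P(\bullet)=x$ and $P(\wedge_k(T_1,\dots,T_k))=y+\prod_{i=1}^k P(T_i)$ for $k\ge 1$. *)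

(* Defs.v *)
From HB Require Import structures.
From mathcomp Require Import all_boot all_order all_algebra.
From mathcomp Require Import mpoly.

Set Implicit Arguments.
Unset Strict Implicit.
Unset Printing Implicit Defensive.

Import GRing.Theory.
Local Open Scope ring_scope.

(* [symmetric] is qualified because mpoly.v redefines it.
   The last clause says that there is no cycle: [ucycle] also accepts the
   empty cycle and the back-and-forth walk [:: u; v] along an edge, hence the
   bound 2. *)
Definition is_tree (V : finType) (e : rel V) : Prop :=
  [/\ ssrbool.symmetric e,
      irreflexive e,
      forall u v : V, connect e u v
    & forall s : seq V, ucycle e s -> (size s <= 2)%N].

Record rooted_tree := RootedTree {
  vertex : finType;
  edge : rel vertex;
  root : vertex;
  edge_tree : is_tree edge
}.

Arguments edge : clear implicits.
Arguments root : clear implicits.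

Definition rooted_iso (T1 T2 : rooted_tree) : Prop :=
  exists f : vertex T1 -> vertex T2,
    [/\ bijective f,
        f (root T1) = root T2
      & forall u v, edge T2 (f u) (f v) = edge T1 u v].

(* The children of [v], where [p] is the parent of [v] ([None] if [v] is the
   root). *)
Definition children (T : rooted_tree) (p : option (vertex T)) (v : vertex T) :
    {set vertex T} :=
  [set c | edge T v c & Some c != p].

(* The polynomial of the subtree hanging from [v], whose parent is [p].  The
   number [n] only bounds the depth of the recursion; the value 0 is never
   reached when [n] is at least the height of that subtree plus one. *)
Fixpoint subtree_poly (T : rooted_tree) (n : nat) (p : option (vertex T))
    (v : vertex T) : {mpoly int[2]} :=
  if n is n'.+1 then
    if children p v == set0 then 'X_(0 : 'I_2)
    else 'X_(1 : 'I_2)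
         + \prod_(c in children p v) subtree_poly n' (Some v) c
  else 0.

Definition tree_poly (T : rooted_tree) : {mpoly int[2]} :=
  subtree_poly #|vertex T| None (root T).

(* The rest of this file checks that [tree_poly] satisfies the two equations
   P(bullet) = x and P(wedge_k(T_1, ..., T_k)) = y + P(T_1) ... P(T_k), k >= 1:
   see [tree_poly_bullet] and [tree_poly_wedge]. *)

Section Ancestry.

Variable T : rooted_tree.
Implicit Types (v c : vertex T) (anc : seq (vertex T)).

(* [anc] lists the proper ancestors of [v], from its parent to the root. *)
Definition ancestry v anc : bool :=
  [&& path (edge T) v anc, uniq (v :: anc) & last v anc == root T].

Lemma ancestry_root : ancestry (root T) [::].
Proof. by rewrite /ancestry /=. Qed.

Lemma ancestry_child v anc c :
  ancestry v anc -> c \in children (ohead anc) v -> ancestry c (v :: anc).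
Proof.
case: (edge_tree T) => esym eirr _ eac.
case/and3P=> pth un lst; rewrite inE => /andP[evc cp].
have cv : c != v by apply: contraTneq evc => ->; rewrite eirr.
rewrite /ancestry /= esym evc pth lst inE negb_or cv /=.
move: (un) => /= ->; rewrite !andbT; apply/negP => canc.
case/splitPr: anc / canc lst pth un cp => s1 s2.
move=> _; rewrite cat_path /= => /and3P[p1 e1 _] un cp.
case: s1 p1 e1 un cp => [|a s1] p1 e1 un cp; first by rewrite /= eqxx in cp.
have /eac : ucycle (edge T) (v :: rcons (a :: s1) c); last first.
  by rewrite /= size_rcons.
rewrite /ucycle; apply/andP; split.
  rewrite /cycle rcons_path last_rcons [edge T c v]esym evc andbT.
  by rewrite rcons_path p1.
have: uniq ((v :: rcons (a :: s1) c) ++ s2) by rewrite cat_cons cat_rcons.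
by rewrite cat_uniq => /andP[].
Qed.

Lemma ancestry_size v anc : ancestry v anc -> (size anc < #|vertex T|)%N.
Proof. by case/and3P=> _ /card_uniqP szE _; rewrite -[_.+1]szE max_card. Qed.

Lemma ancestry_child_root v anc c :
  ancestry v anc -> c \in children (ohead anc) v -> c != root T.
Proof.
move=> av cc; have /and3P[_ un lst] := ancestry_child av cc.
apply: contraTneq un => ->; rewrite -(eqP lst) /= negb_and negbK.
by rewrite mem_last.
Qed.

Lemma subtree_poly_fuel n m v anc :
    ancestry v anc -> (#|vertex T| <= size anc + n)%N ->
    (#|vertex T| <= size anc + m)%N ->
  subtree_poly n (ohead anc) v = subtree_poly m (ohead anc) v.
Proof.
elim: n m v anc => [|n IHn] [|m] v anc av //.
- by rewrite addn0 leqNgt (ancestry_size av).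
- by move=> _; rewrite addn0 leqNgt (ancestry_size av).
rewrite !addnS -!addSn => hn hm /=; case: ifP => // _; congr (_ + _).
apply: eq_bigr => c cc; exact: (IHn m c (v :: anc) (ancestry_child av cc)).
Qed.

End Ancestry.

Lemma bullet_is_tree : is_tree (fun _ _ : unit => false).
Proof.
split=> [||[] []|] //.
case=> [|u [|v s]] //; by rewrite /ucycle /= !andFb.
Qed.

Definition bullet : rooted_tree := RootedTree tt bullet_is_tree.

Section Wedge.

Variables (k : nat) (T : 'I_k -> rooted_tree).

Local Notation wvertex := (option {i : 'I_k & vertex (T i)}).

Definition wedge_edge : rel wvertex := fun a b =>
  match a, b with
  | None, None => false
  | None, Some b => tagged b == root (T (tag b))
  | Some a, None => tagged a == root (T (tag a))
  | Some a, Some b =>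
      (tag a == tag b) && edge (T (tag a)) (tagged a) (tagged_as a b)
  end.

Definition wedge_emb (i : 'I_k) (v : vertex (T i)) : wvertex :=
  Some (Tagged (fun i => vertex (T i)) v).

Lemma wedge_emb_inj i : injective (@wedge_emb i).
Proof. by move=> u v [] /eqP; rewrite eq_Tagged => /eqP. Qed.

Lemma wedge_edge_emb i u v :
  wedge_edge (@wedge_emb i u) (wedge_emb v) = edge (T i) u v.
Proof. by rewrite /wedge_edge /= eqxx tagged_asE. Qed.

Lemma wedge_edge_sym : ssrbool.symmetric wedge_edge.
Proof.
move=> [[i u]|] [[j v]|] //=.
have [ij|//] := eqVneq i j.
by subst j; rewrite !tagged_asE; case: (edge_tree (T i)) => ->.
Qed.

Lemma wedge_path i v s : None \notin s -> path wedge_edge (@wedge_emb i v) s ->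
  exists2 s', s = map (@wedge_emb i) s' & path (edge (T i)) v s'.
Proof.
elim: s v => [|[[j u]|] s IHs] v //; first by exists [::].
rewrite inE /= => Ns /andP[/andP[/eqP ij]]; subst j.
rewrite tagged_asE => evu /(IHs _ Ns)[s' -> ps'].
by exists (u :: s'); rewrite //= evu.
Qed.

Lemma wedge_is_tree : is_tree wedge_edge.
Proof.
split.
- exact: wedge_edge_sym.
- case=> [[i u]|] //=; rewrite eqxx tagged_asE.
  by case: (edge_tree (T i)) => _ ->.
- have to_root a : connect wedge_edge a None.
    case: a => [[i u]|] //.
    case: (edge_tree (T i)) => _ _ /(_ u (root (T i)))/connectP[p pp lp] _.
    apply/connectP; exists (rcons (map (@wedge_emb i) p) None).
      rewrite rcons_path -/(wedge_emb u) last_map -lp /= eqxx andbT.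
      rewrite path_map; apply: sub_path pp => x y.
      by rewrite /= eqxx tagged_asE.
    by rewrite last_rcons.
  move=> a b; apply: connect_trans (to_root a) _.
  by rewrite (sym_connect_sym wedge_edge_sym) to_root.
- move=> s /andP[cs us].
  have [Ns|Ns] := boolP (None \in s).
    have [n s1 def_s] := rot_to Ns.
    move: cs us; rewrite -(rot_cycle n) -(rot_uniq n) -(size_rot n) def_s.
    case: s1 {def_s} => [|[[i u]|] s2] //=.
    rewrite rcons_path inE => /and3P[/eqP -> /= ps2].
    rewrite -/(wedge_emb _) => ls2 /and3P[Ns2 us2 us].
    have [s2' def_s2 _] := wedge_path Ns2 ps2.
    case: s2' def_s2 => [|w s2'] def_s2; first by rewrite def_s2.
    move: ls2 us2; rewrite def_s2 last_map /= => /eqP ls2.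
    rewrite -[X in X \notin _]/(wedge_emb (root (T i))) -map_cons.
    by rewrite (mem_map (@wedge_emb_inj i)) -ls2 mem_last.
  case: s cs us Ns => [|[[i u]|] s] //=.
  rewrite rcons_path -/(wedge_emb u) inE => /andP[ps ls] us Ns.
  have [s' def_s ps'] := wedge_path Ns ps.
  case: (edge_tree (T i)) => _ _ _ /(_ (u :: s')).
  rewrite def_s size_map; apply; apply/andP; split.
    rewrite /= rcons_path ps' /=.
    by move: ls; rewrite def_s last_map wedge_edge_emb.
  rewrite -(map_inj_uniq (@wedge_emb_inj i)) /= -def_s.
  exact: us.
Qed.

Definition wedge : rooted_tree := RootedTree None wedge_is_tree.

End Wedge.

Lemma tree_poly_bullet : tree_poly bullet = 'X_(0 : 'I_2).
Proof.
by rewrite /tree_poly card_unit /= (_ : children _ _ = set0) ?eqxx.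
Qed.

Section WedgePoly.

Variables (k : nat) (T : 'I_k -> rooted_tree).

Lemma children_wedge_root :
  children None (root (wedge T)) =
  [set wedge_emb (root (T i)) | i : 'I_k].
Proof.
apply/setP=> c; rewrite inE andbT; apply/idP/imsetP => [|[i _ ->]] /=.
  by case: c => [[i v]|] //= /eqP ->; exists i.
exact: eqxx.
Qed.

Definition wedge_parent i (q : option (vertex (T i))) :
    option (vertex (wedge T)) :=
  Some (if q is Some u then wedge_emb u else None).

Lemma children_wedge_emb i v anc : @ancestry (T i) v anc ->
  children (wedge_parent (ohead anc)) (wedge_emb v : vertex (wedge T)) =
  [set wedge_emb c | c in children (ohead anc) v].
Proof.
move=> av; apply/setP=> c; rewrite inE; apply/andP/imsetP => [[]|[d + ->]].
  case: c => [[j c]|].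
    case/andP=> /= /eqP ij; subst j; rewrite tagged_asE => evc cp.
    exists c => //; rewrite inE evc /=; apply: contraNneq cp => <-.
    by [].
  move=> /= /eqP vr; case: anc av => [|p anc] //= /and3P[_ un lst].
  by move: un; rewrite /= vr -(eqP lst) /= mem_last.
rewrite inE => /andP[evd dp]; split; first by rewrite /= eqxx tagged_asE.
apply: contraNneq dp; rewrite /wedge_parent; case: (ohead anc) => [p|] //.
by case=> /eqP; rewrite eq_Tagged => /eqP /= ->.
Qed.

Lemma subtree_poly_wedge n i v anc : @ancestry (T i) v anc ->
  subtree_poly n (wedge_parent (ohead anc)) (wedge_emb v : vertex (wedge T)) =
  subtree_poly n (ohead anc) v.
Proof.
elim: n v anc => [|n IHn] v anc av //=.
rewrite (children_wedge_emb av) imset_eq0; case: ifP => // _; congr (_ + _).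
rewrite big_imset /=; last by move=> c d _ _; apply: wedge_emb_inj.
by apply: eq_bigr => c cc; apply: (IHn c (v :: anc)); apply: ancestry_child.
Qed.

Lemma card_wedge (i : 'I_k) : (#|vertex (T i)| < #|vertex (wedge T)|)%N.
Proof.
rewrite card_option ltnS card_tagged sumnE big_map big_enum /=.
by rewrite (bigD1 i) //= leq_addr.
Qed.

Lemma tree_poly_wedge : (0 < k)%N ->
  tree_poly (wedge T) = 'X_(1 : 'I_2) + \prod_(i < k) tree_poly (T i).
Proof.
move=> k0; rewrite {1}/tree_poly.
have := card_wedge; case: #|vertex (wedge T)| => [/(_ (Ordinal k0))//|n] hn.
rewrite /= children_wedge_root.
case: eqP => [/setP/(_ (wedge_emb (root (T (Ordinal k0)))))|_].
  by rewrite inE => /negP[]; apply/imsetP; exists (Ordinal k0).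
congr (_ + _); rewrite big_imset /=; last first.
  by move=> i j _ _ [].
apply: eq_bigr => i _.
rewrite (@subtree_poly_wedge n i _ [::]) ?ancestry_root //.
exact: (subtree_poly_fuel (ancestry_root _) (hn i)).
Qed.

End WedgePoly.

(* Main.v *)
From mathcomp Require Import all_boot all_order all_algebra.
From mathcomp Require Import mpoly zify ring.
Require Import Defs.

(** That isomorphic trees have equal polynomials holds because an isomorphism
carries children to children, so it reindexes the product at every vertex.

For the converse, the factors P(T_1), ..., P(T_k) have to be recovered, up to
order, from their product P(T) - y; this is unique factorisation once every
P(T) is known to be irreducible.  Irreducibility comes from Eisenstein's
criterion with respect to y, P(T) being seen as a polynomial in x: modulo y it
is a power of x, and its constant term is divisible by y exactly once as soon as
T has an edge; the remaining polynomial x has degree one.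

The argument already works after specialising y to a prime number p at least as
large as the trees.  Everything then happens in Z[x], with the usual form of
Eisenstein's criterion at p.  The constant term of P(T) is k y modulo y^2, where
k is positive when T has an edge, and smaller than the number of vertices (a root with a single child adds 1 to the k of that
child, any larger number of children resets k to 1), so that p does not divide
k.  Hence the specialised polynomials are irreducible ([spec_poly_irreducible]);
as they are monic, equal products match their factors one by one
([prod_irredp_matching]), and two vertices with the same specialised polynomial
have matching children ([kids_matching]).

Applying these matchings from the root downwards yields an injective map from
one tree to the other that respects roots and children
([spec_poly_embedding]).  By symmetry there is one in each direction, so the
trees have the same size and the first map is an isomorphism
([tree_embeddings_iso]). *)

Set Implicit Arguments.
Unset Strict Implicit.
Unset Printing Implicit Defensive.

Import GRing.Theory.
Local Open Scope ring_scope.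

(** * Unique factorisation into monic irreducible polynomials *)

Lemma irredp_dvdp_prod (R : idomainType) (I : finType) (B : {set I})
    (g : I -> {poly R}) (p : {poly R}) :
  irreducible_poly p -> p %| \prod_(i in B) g i -> exists2 i, i \in B & p %| g i.
Proof.
move=> irr_p p_dv; apply/exists_inP; apply: contraTT p_dv => /exists_inPn ndv.
rewrite -irreducible_poly_coprime //.
apply: (big_ind (fun q => coprimep p q)) => [|q r|i /ndv].
- exact: coprimep1.
- by rewrite coprimepMr => -> ->.
- by rewrite -irreducible_poly_coprime.
Qed.

(** Unique factorisation, stated as a matching between the two families of
factors.  Over a mere integral domain [%|] is divisibility over the field of
fractions; this suffices because two associate monic polynomials are equal
already over the domain.  The point [j0] only provides values of [s] outside
[A]. *)
Lemma prod_irredp_matching (R : idomainType) (I J : finType) (j0 : J)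
    (f : I -> {poly R}) (g : J -> {poly R}) (A : {set I}) (B : {set J}) :
    (forall i, f i \is monic /\ irreducible_poly (f i)) ->
    (forall j, g j \is monic /\ irreducible_poly (g j)) ->
    \prod_(i in A) f i = \prod_(j in B) g j ->
  exists s : I -> J, [/\ {in A, forall i, s i \in B},
    {in A, forall i, g (s i) = f i} & {in A &, injective s}].
Proof.
move=> fP gP; have [n] := ubnP #|A|; elim: n A B => // n IHn A B /ltnSE leAn.
have [->|[i iA]] := set_0Vmem A.
  by exists (fun=> j0); split=> i; rewrite ?inE.
rewrite (big_setD1 i) //= => eqAB.
have [fm firr] := fP i.
have [j jB fgij] : exists2 j, j \in B & f i %| g j.
  by apply: irredp_dvdp_prod => //; rewrite -eqAB dvdp_mulr.
have [gm girr] := gP j.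
have /eqP eq_fg : f i == g j.
  by rewrite -eqp_monic //; apply: girr => //; rewrite gtn_eqF ?firr.1.
move: eqAB; rewrite (big_setD1 j) //= eq_fg.
move/(mulfI (monic_neq0 gm)) => eqAB.
have [|s [sB sg sI]] := IHn _ _ _ eqAB.
  by move: leAn; rewrite (cardsD1 i) iA.
exists (fun x => if x == i then j else s x); split=> x.
- case: eqP => // /eqP xi xA; have /sB : x \in A :\ i by rewrite !inE xi.
  by rewrite !inE => /andP[].
- case: eqP => [-> //|/eqP xi xA]; apply: sg.
  by rewrite !inE xi.
- move=> y xA yA; case: eqP => [->|/eqP xi]; case: eqP => [->|/eqP yi] // E.
  + have /sB : y \in A :\ i by rewrite !inE yi.
    by rewrite -E !inE eqxx.
  + have /sB : x \in A :\ i by rewrite !inE xi.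
    by rewrite E !inE eqxx.
  + by apply: sI => //; rewrite !inE ?xi ?yi.
Qed.

(** * Polynomials that are a power of X modulo p *)

(** Besides q = X^m modulo p, the bound on [r] forces q to be monic of degree
[m], so that these are the polynomials to which Eisenstein's criterion applies
as soon as p^2 does not divide the constant term. *)
Definition power_mod (p : nat) (q : {poly int}) : Prop :=
  exists (m : nat) (r : {poly int}),
    [/\ (0 < m)%N, (size r <= m)%N & q = 'X^m + p%:Z *: r].

Section PowerMod.

Variable p : nat.

Lemma power_mod_X : power_mod p 'X.
Proof. by exists 1%N, 0; rewrite size_poly0 scaler0 addr0 expr1. Qed.

Lemma power_modM q1 q2 : power_mod p q1 -> power_mod p q2 -> power_mod p (q1 * q2).
Proof.
move=> [m1 [r1 [m1_gt0 sz1 ->]]] [m2 [r2 [m2_gt0 sz2 ->]]].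
exists (m1 + m2)%N, ('X^m1 * r2 + 'X^m2 * r1 + p%:Z *: (r1 * r2)).
split; first by rewrite addn_gt0 m1_gt0.
  have szX (m : nat) (r : {poly int}) : (size ('X^m * r)%R <= m + size r)%N.
    by rewrite (leq_trans (size_polyMleq _ _)) // size_polyXn.
  rewrite (leq_trans (size_polyD _ _)) // geq_max; apply/andP; split.
    rewrite (leq_trans (size_polyD _ _)) // geq_max; apply/andP; split.
      by rewrite (leq_trans (szX _ _)) // leq_add2l.
    by rewrite (leq_trans (szX _ _)) // addnC leq_add2r.
  rewrite (leq_trans (size_scale_leq _ _)) //.
  rewrite (leq_trans (size_polyMleq _ _)) // (leq_trans (leq_pred _)) //.
  exact: leq_add.
by rewrite exprD -!mul_polyC; ring.
Qed.

(** The empty product is excluded because [power_mod] requires a positive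
degree. *)
Lemma power_mod_prod (I : finType) (A : {set I}) (f : I -> {poly int}) :
  A != set0 -> (forall i, i \in A -> power_mod p (f i)) ->
  power_mod p (\prod_(i in A) f i).
Proof.
have [n] := ubnP #|A|; elim: n A => // n IHn A /ltnSE leAn /set0Pn[i iA] fP.
rewrite (big_setD1 i) //=; have [->|A'n0] := eqVneq (A :\ i) set0.
  by rewrite big_set0 mulr1; apply: fP.
apply: power_modM; first exact: fP.
apply: IHn => // [|j]; first by move: leAn; rewrite (cardsD1 i) iA.
by rewrite inE => /andP[_ /fP].
Qed.

Lemma power_mod_addC q : power_mod p q -> power_mod p (p%:Z%:P + q).
Proof.
move=> [m [r [m_gt0 sz ->]]]; exists m, (r + 1); split=> //.
  by rewrite (leq_trans (size_polyD _ _)) // geq_max sz size_poly1.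
by rewrite -!mul_polyC; ring.
Qed.

Lemma power_mod_coef0 q : power_mod p q -> (p %| q`_0)%Z.
Proof.
move=> [m [r [m_gt0 sz ->]]].
by rewrite coefD coefXn coefZ ltn_eqF // add0r dvdz_mulr.
Qed.

Lemma power_mod_monic q : power_mod p q -> q \is monic.
Proof.
move=> [m [r [m_gt0 sz ->]]]; rewrite monicE lead_coefDl ?lead_coefXn //.
by rewrite size_polyXn ltnS (leq_trans (size_scale_leq _ _)).
Qed.

Lemma power_mod_irreducible q : prime p -> power_mod p q ->
  ~~ ((p ^ 2)%N %| q`_0)%Z -> irreducible_poly q.
Proof.
move=> p_pr qP q0; have := power_mod_monic qP.
move: qP q0 => [m [r [m_gt0 sz ->]]] q0 qm.
have szq : size ('X^m + p%:Z *: r : {poly int}) = m.+1.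
  by rewrite size_polyDl size_polyXn // ltnS (leq_trans (size_scale_leq _ _)).
apply: (eisenstein_crit p_pr) => //.
- by rewrite szq eqSS -lt0n.
- by rewrite (monicP qm) dvdz1 /= gtn_eqF ?prime_gt1.
- rewrite szq /= => i lti.
  by rewrite coefD coefXn coefZ ltn_eqF // add0r dvdz_mulr.
Qed.

End PowerMod.

(** * The parent structure of a rooted tree *)

Section Tree.

Variable T : rooted_tree.
Local Notation V := (vertex T).
Implicit Types (u v c : V) (a : seq V).

Lemma ancestry_exists v : exists a, ancestry v a.
Proof.
have [_ _ conn _] := edge_tree T.
have /connectP[s /shortenP[a pa ua _] Er] := conn v (root T).
by exists a; rewrite /ancestry pa ua Er eqxx.
Qed.

Lemma ancestry_parent v u a :
  ancestry v (u :: a) -> ancestry u a /\ v \in children (ohead a) u.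
Proof.
have [esym _ _ _] := edge_tree T.
case/and3P=> /= /andP[evu pa] /and3P[va ua uniqa] lasta; split.
  by rewrite /ancestry pa /= ua uniqa.
rewrite inE esym evu /=; case: a va {pa ua uniqa lasta} => // w a.
by rewrite !inE !negb_or => /and3P[_ vw _]; apply: contraNneq vw => -[->].
Qed.

(** If the parents [x] and [y] of [v] in the two lists differ, then [v] can be
reached from [x] and continued to [y], which gives [y] the ancestor list
[v :: x :: a]; but the list [b] of ancestors of [y] avoids [v].  The induction
is on [b], for all [v], so it applies to [y]. *)
Lemma ancestry_unique v a b : ancestry v a -> ancestry v b -> a = b.
Proof.
have [esym _ _ _] := edge_tree T.
have root_nil w d : ancestry w d -> w = root T -> d = [::].
  case: d => // x d /and3P[_ /= /andP[wd _] lastd] wr.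
  by move: wd; rewrite wr -(eqP lastd) mem_last.
elim: b v a => [|y b IHb] v a av bv.
  by apply: (root_nil v) => //; apply/eqP; have /and3P[] := bv.
case: a av => [|x a] av.
  by rewrite (root_nil _ _ bv) //; apply/eqP; have /and3P[] := av.
have [by_ vy] := ancestry_parent bv; have [ax _] := ancestry_parent av.
have [xy|xy] := eqVneq x y.
  by rewrite xy (IHb y a) // -xy.
have yv : y \in children (ohead (x :: a)) v.
  rewrite inE /= eq_sym; have /and3P[/= /andP[-> _] _ _] := bv.
  by apply: contraNneq xy => -[->].
have Eb := IHb y _ (ancestry_child av yv) by_.
by have /and3P[_ /= + _] := bv; rewrite -Eb !inE eqxx orbT.
Qed.

(** Parents are not data of a rooted tree: choosing the unique ancestor list of
every vertex makes [kids], and then the polynomial of the subtree at [v],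
functions of the vertex alone. *)
Definition ancestors v : seq V := xchoose (ancestry_exists v).

Definition kids v : {set V} := children (ohead (ancestors v)) v.

Lemma ancestorsP v : ancestry v (ancestors v).
Proof. exact: xchooseP. Qed.

Lemma ancestorsE v a : ancestry v a -> ancestors v = a.
Proof. exact/ancestry_unique/ancestorsP. Qed.

Lemma ancestors_root : ancestors (root T) = [::].
Proof. exact/ancestorsE/ancestry_root. Qed.

Lemma ancestors_kid u c : c \in kids u -> ancestors c = u :: ancestors u.
Proof. by move=> cu; apply/ancestorsE/ancestry_child/cu/ancestorsP. Qed.

Lemma ancestors_cons v u a :
  ancestors v = u :: a -> v \in kids u /\ a = ancestors u.
Proof.
move=> Ev; have := ancestorsP v; rewrite Ev => /ancestry_parent[ua vu].
by rewrite /kids (ancestorsE ua).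
Qed.

Lemma kids_neq_root u c : c \in kids u -> c != root T.
Proof. exact/ancestry_child_root/ancestorsP. Qed.

Lemma kids_inj u u' c : c \in kids u -> c \in kids u' -> u = u'.
Proof. by move=> /ancestors_kid E /ancestors_kid; rewrite E => -[]. Qed.

Lemma root_or_kid v : v = root T \/ exists u, v \in kids u.
Proof.
case Ev: (ancestors v) => [|u a].
  by left; apply/eqP; have /and3P[] := ancestorsP v; rewrite Ev.
by right; exists u; case: (ancestors_cons Ev).
Qed.

(** The graph is determined by the parent structure, so that maps between trees
need only be checked on children. *)
Lemma edge_kids u v : edge T u v = (v \in kids u) || (u \in kids v).
Proof.
have [esym _ _ _] := edge_tree T; apply/idP/orP; last first.
  by case; rewrite inE => /andP[+ _]; rewrite // esym.
move=> euv; have [|vu] := boolP (v \in kids u); first by left.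
right; move: vu; rewrite inE euv /= negbK.
case Eu: (ancestors u) => [|w a] //= /eqP[->].
by case: (ancestors_cons Eu).
Qed.

Lemma top_down (P : V -> Prop) :
  P (root T) -> (forall u c, c \in kids u -> P u -> P c) -> forall v, P v.
Proof.
move=> Pr Pk v; move Ea: (ancestors v) => a; elim: a v Ea => [|u a IHa] v Ev.
  by case: (root_or_kid v) => [->|[u /ancestors_kid]]; rewrite ?Ev.
by have [vu Ea] := ancestors_cons Ev; apply: Pk vu _; apply: IHa.
Qed.

Lemma size_ancestors v : (size (ancestors v) < #|V|)%N.
Proof. exact/ancestry_size/ancestorsP. Qed.

Lemma bottom_up (P : V -> Prop) :
  (forall v, (forall c, c \in kids v -> P c) -> P v) -> forall v, P v.
Proof.
move=> Pk v; have [n] := ubnP (#|V| - size (ancestors v)).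
elim: n v => // n IHn v le_n; apply: Pk => c cv; apply: IHn.
by move: le_n (size_ancestors v); rewrite (ancestors_kid cv) /=; lia.
Qed.

(** * The polynomials of the subtrees and their irreducibility *)

Definition vertex_poly v : {mpoly int[2]} :=
  subtree_poly #|V| (ohead (ancestors v)) v.

(** One recursion step consumes one unit of fuel; starting from [#|V|.+1]
instead of [#|V|], which does not change the value at [v], leaves exactly the
fuel [#|V|] used in [vertex_poly] for the kids. *)
Lemma vertex_polyE v : vertex_poly v =
  if kids v == set0 then 'X_(0 : 'I_2)
  else 'X_(1 : 'I_2) + \prod_(c in kids v) vertex_poly c.
Proof.
have szv := size_ancestors v.
rewrite /vertex_poly.
rewrite (@subtree_poly_fuel _ _ #|V|.+1 _ _ (ancestorsP v)) ?addnS; try lia.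
rewrite /= -/(kids v); case: ifP => // _; congr (_ + _).
by apply: eq_bigr => c cv; rewrite (ancestors_kid cv).
Qed.

Section Specialise.

Variable p : nat.

Definition specialise : {mpoly int[2]} -> {poly int} :=
  mmap polyC (fun i => if i == 0 then 'X else p%:Z%:P).

Definition spec_poly v : {poly int} := specialise (vertex_poly v).

Lemma spec_polyE v : spec_poly v =
  if kids v == set0 then 'X
  else p%:Z%:P + \prod_(c in kids v) spec_poly c.
Proof.
rewrite /spec_poly /specialise vertex_polyE; case: ifP => _.
  by rewrite mmapX mmap1U.
by rewrite rmorphD rmorph_prod /= mmapX mmap1U.
Qed.

Lemma power_mod_spec v : power_mod p (spec_poly v).
Proof.
elim/bottom_up: v => v IH; rewrite spec_polyE; case: ifPn => [_|kn0].
  exact: power_mod_X.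
exact/power_mod_addC/power_mod_prod.
Qed.

(** This controls the constant term modulo p^2.  The number [k] counts
the inner vertices met when going down from [v] through single children, up to
and including the first branching vertex.  Bounding it together with the depth
of [v] makes the induction go through, and keeps [k] below p when the tree has
at most p vertices. *)
Lemma spec_poly_coef0 v : exists (k : nat) (b : int),
  [/\ (spec_poly v)`_0 = p%:Z * (k%:Z + p%:Z * b),
      (k + size (ancestors v) < #|V|)%N & (0 < k)%N = (kids v != set0)].
Proof.
elim/bottom_up: v => v IH; rewrite spec_polyE; case: ifPn => [_|kn0].
  exists 0%N, 0; rewrite coefX /= !(mulr0, addr0) add0n.
  by split=> //; apply: size_ancestors.
(* With one kid [c] the constant term is p plus that of [c]; with several, the
   product of the constant terms of the kids is divisible by p^2. *)
have /set0Pn[c cv] := kn0.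
have [k [b [Ec ltk _]]] := IH c cv.
move: ltk; rewrite (ancestors_kid cv) /= addnS -addSn => ltk.
rewrite (big_setD1 c) //=.
have [->|kn0'] := eqVneq (kids v :\ c) set0.
  exists k.+1, b; split=> //.
  by rewrite big_set0 mulr1 coefD coefC /= Ec intS; ring.
have /power_mod_coef0/dvdzP[d Ed] :
    power_mod p (\prod_(i in kids v :\ c) spec_poly i).
  by apply: power_mod_prod => // i _; apply: power_mod_spec.
exists 1%N, ((k%:Z + p%:Z * b) * d); split=> //; last by lia.
by rewrite coefD coefC coef0M /= Ec Ed; ring.
Qed.

Hypotheses (p_prime : prime p) (p_gt : (#|V| <= p)%N).

(** The number [k] of [spec_poly_coef0] satisfies [0 < k < p]. *)
Lemma spec_poly_inner v :
  kids v != set0 -> ~~ ((p ^ 2)%N %| (spec_poly v)`_0)%Z.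
Proof.
have [k [b [-> ltk]]] := spec_poly_coef0 v => <- k_gt0.
have p_gt0 := prime_gt0 p_prime.
rewrite -mulnn PoszM dvdz_mul2l; last by rewrite eqz_nat; lia.
rewrite rpredDr ?dvdz_mulr // dvdzE /= gtnNdvd //.
by apply: leq_trans p_gt; apply: leq_ltn_trans ltk; apply: leq_addr.
Qed.

Lemma spec_poly_monic v : spec_poly v \is monic.
Proof. exact/power_mod_monic/power_mod_spec. Qed.

(** The polynomial X of a leaf has constant term 0 and escapes Eisenstein's
criterion, but it has degree one. *)
Lemma spec_poly_irreducible v : irreducible_poly (spec_poly v).
Proof.
have [kv0|kv] := eqVneq (kids v) set0.
  by rewrite spec_polyE kv0 eqxx -['X]subr0; apply: irredp_XsubC.
exact: power_mod_irreducible (power_mod_spec v) (spec_poly_inner kv).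
Qed.

End Specialise.
End Tree.

(** * Reconstructing the tree *)

(** A leaf and an inner vertex are told apart by the constant term, which is 0
only for the leaf; two inner vertices have equal products over their kids. *)
Lemma kids_matching (T1 T2 : rooted_tree) (p : nat) (u : vertex T1)
    (w : vertex T2) :
    prime p -> (#|vertex T1| <= p)%N -> (#|vertex T2| <= p)%N ->
    spec_poly p u = spec_poly p w ->
  exists s : vertex T1 -> vertex T2, [/\ {in kids u, forall c, s c \in kids w},
    {in kids u, forall c, spec_poly p (s c) = spec_poly p c}
    & {in kids u &, injective s}].
Proof.
move=> p_pr p1 p2 Euw.
have [u0|un0] := eqVneq (kids u) set0.
  by exists (fun=> root T2); split=> c; rewrite u0 inE.
have wn0 : kids w != set0.
  apply: contraNneq (spec_poly_inner p_pr p1 un0) => w0.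
  by rewrite Euw spec_polyE w0 eqxx coefX dvdz0.
apply: (prod_irredp_matching (root T2)) => [c|c|].
- by split; [apply: spec_poly_monic | apply: spec_poly_irreducible].
- by split; [apply: spec_poly_monic | apply: spec_poly_irreducible].
by move: Euw; rewrite !spec_polyE (negPf un0) (negPf wn0) => /addrI.
Qed.

Definition tree_embedding (T1 T2 : rooted_tree) (f : vertex T1 -> vertex T2) :=
  [/\ injective f, f (root T1) = root T2
    & forall u c, c \in kids u -> f c \in kids (f u)].

(** A matching of kids is chosen for every pair of vertices with equal
polynomials, and [f] is computed along the list of ancestors, from the root
down: the image of a kid of [u] is given by the matching chosen for
[(u, f u)].  Injectivity follows because [f v] determines its parent [f u],
hence [u] by induction, and matchings are injective. *)
Lemma spec_poly_embedding (T1 T2 : rooted_tree) (p : nat) :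
    prime p -> (#|vertex T1| <= p)%N -> (#|vertex T2| <= p)%N ->
    spec_poly p (root T1) = spec_poly p (root T2) ->
  exists f : vertex T1 -> vertex T2, tree_embedding f.
Proof.
move=> p_pr p1 p2 Er.
have matching (x : vertex T1 * vertex T2) : exists s : vertex T1 -> vertex T2,
    spec_poly p x.1 = spec_poly p x.2 ->
    [/\ {in kids x.1, forall c, s c \in kids x.2},
    {in kids x.1, forall c, spec_poly p (s c) = spec_poly p c}
    & {in kids x.1 &, injective s}].
  have [Ex|nEx] := eqVneq (spec_poly p x.1) (spec_poly p x.2).
    by have [s sP] := kids_matching p_pr p1 p2 Ex; exists s.
  by exists (fun=> root T2) => Ex; rewrite Ex eqxx in nEx.
have [s sP] := fin_all_exists matching.
pose g := fix g (a : seq (vertex T1)) (v : vertex T1) :=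
  if a is u :: a' then s (u, g a' u) v else root T2.
pose f v := g (ancestors v) v.
have f_root : f (root T1) = root T2 by rewrite /f ancestors_root.
have f_kid u c : c \in kids u -> f c = s (u, f u) c.
  by move=> cu; rewrite {1}/f (ancestors_kid cu).
have f_spec v : spec_poly p v = spec_poly p (f v).
  elim/top_down: v => [|u c cu Eu]; first by rewrite f_root.
  by rewrite (f_kid u) //; have [_ ->] := sP (u, f u) Eu.
have f_kids u c : c \in kids u -> f c \in kids (f u).
  by move=> cu; rewrite (f_kid u) //; have [->] := sP (u, f u) (f_spec u).
exists f; split=> // v; elim/top_down: v => [|u c cu IHu] v.
  rewrite f_root; case: (root_or_kid v) => [-> //|[w vw]] Ev.
  by have := kids_neq_root (f_kids _ _ vw); rewrite -Ev eqxx.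
move=> Ecv; case: (root_or_kid v) => [vr|[w vw]].
  by have := kids_neq_root (f_kids _ _ cu); rewrite Ecv vr f_root eqxx.
have uw : u = w.
  apply: IHu; apply: (kids_inj (f_kids _ _ cu)).
  by rewrite Ecv f_kids.
move: Ecv vw; rewrite -uw => Ecv vu; move: Ecv; rewrite (f_kid _ _ cu) (f_kid _ _ vu).
by have [_ _] := sP (u, f u) (f_spec u); apply.
Qed.

(** The map [g] forces both trees to have the same number of vertices, so [f]
is surjective.  That [f] also reflects the
parent relation follows from injectivity, [f] mapping the parent of a vertex to
the parent of its image. *)
Lemma tree_embeddings_iso (T1 T2 : rooted_tree) (f : vertex T1 -> vertex T2)
    (g : vertex T2 -> vertex T1) :
  tree_embedding f -> tree_embedding g -> rooted_iso T1 T2.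
Proof.
move=> [f_inj f_root f_kids] [g_inj _ _].
exists f; split=> //; first by apply: inj_card_bij f_inj (leq_card g g_inj).
have f_kidsE u v : (f v \in kids (f u)) = (v \in kids u).
  apply/idP/idP => [fvu|]; last exact: f_kids.
  case: (root_or_kid v) => [vr|[w vw]].
    by have := kids_neq_root fvu; rewrite vr f_root eqxx.
  by rewrite (f_inj _ _ (kids_inj fvu (f_kids _ _ vw))).
by move=> u v; rewrite !edge_kids !f_kidsE.
Qed.

(** * Invariance under isomorphism *)

Lemma subtree_poly_iso (T1 T2 : rooted_tree) (f : vertex T1 -> vertex T2) :
    bijective f -> (forall u v, edge T2 (f u) (f v) = edge T1 u v) ->
  forall n q v, subtree_poly n (omap f q) (f v) = subtree_poly n q v.
Proof.
move=> f_bij f_edge; have f_inj := bij_inj f_bij.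
elim=> // n IHn q v /=.
have -> : children (omap f q) (f v) = f @: children q v.
  have [f' fK f'K] := f_bij; apply/setP=> w.
  rewrite -(f'K w) mem_imset // !inE f_edge; congr (_ && ~~ _).
  by case: q => //= u; rewrite !(inj_eq Some_inj) (inj_eq f_inj).
rewrite imset_eq0 big_imset /=; last by move=> c d _ _ /f_inj.
by under eq_bigr => c _ do rewrite (IHn (Some v)).
Qed.

Lemma tree_polyE (T : rooted_tree) : tree_poly T = vertex_poly (root T).
Proof. by rewrite /tree_poly /vertex_poly ancestors_root. Qed.

Theorem theorem2p8 (T1 T2 : rooted_tree) :
  rooted_iso T1 T2 <-> tree_poly T1 = tree_poly T2.
Proof.
split=> [[f [f_bij f_root f_edge]]|E12].
  rewrite /tree_poly (bij_eq_card f_bij) -f_root.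
  by rewrite -(subtree_poly_iso f_bij f_edge _ None).
have [p p_gt p_pr] := prime_above (maxn #|vertex T1| #|vertex T2|).
have /andP[p1 p2] : (#|vertex T1| <= p)%N && (#|vertex T2| <= p)%N.
  by rewrite -geq_max ltnW.
have Er : spec_poly p (root T1) = spec_poly p (root T2).
  by rewrite /spec_poly -!tree_polyE E12.
have [f fP] := spec_poly_embedding p_pr p1 p2 Er.
have [g gP] := spec_poly_embedding p_pr p2 p1 (esym Er).
exact: tree_embeddings_iso fP gP.
Qed.
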